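(* Let $A=(A,\alpha,\prec,\succ)$ be a multiplicative hom-dendriform algebra over $\mathbb{K}$. If $H^3_{\alpha,\mathrm{Dend}}(A,A)=0$, then every finite order deformation of $A$ extends to a deformation of the next order; that is, for every deformation $(\prec_t,\succ_t)$ of $A$ of order $n$ there exist bilinear maps $\prec_{n+1},\succ_{n+1}$ on $A$ such that $(\prec_t+\prec_{n+1}t^{n+1},\ \succ_t+\succ_{n+1}t^{n+1})$ is a deformation of $A$ of order $n+1$.
   Context: $\mathbb{K}$ is a field of characteristic zero; all spaces and maps are over $\mathbb{K}$. A multiplicative hom-dendriform algebra $(A,\alpha,\prec,\succ)$ is a vector space $A$ with a linear map $\alpha:A\to A$ and bilinear operations $\prec,\succ$ on $A$ such that for all $a,b,c\in A$: $(a\prec b)\prec\alpha(c)=\alpha(a)\prec(b\prec c+b\succ c)$; $(a\succ b)\prec\alpha(c)=\alpha(a)\succ(b\prec c)$; $(a\prec b+a\succ b)\succ\alpha(c)=\alpha(a)\succ(b\succ c)$; and $\alpha(a\prec b)=\alpha(a)\prec\alpha(b)$, $\alpha(a\succ b)=\alpha(a)\succ\alpha(b)$. Cohomology. Let $C_n=\{[1],\dots,[n]\}$ and let $\mathbb{K}[C_n]$ be the vector space with basis $C_n$. For $m,n\ge1$, $1\le i\le m$, define maps $R_0=R_0(m;1,\dots,n,\dots,1):C_{m+n-1}\to C_m$ and $R_i=R_i(m;1,\dots,n,\dots,1):C_{m+n-1}\to\mathbb{K}[C_n]$ (with $n$ in the $i$-th place) by: $R_0[r]=[r]$ if $r\le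 i-1$, $R_0[r]=[i]$ if $i\le r\le i+n-1$, $R_0[r]=[r-n+1]$ if $i+n\le r\le m+n-1$; and $R_i[r]=[r-(i-1)]$ if $i\le r\le i+n-1$, $R_i[r]=[1]+\cdots+[n]$ otherwise. For $n\ge1$, $C^n_{\alpha,\mathrm{Dend}}(A,A)$ is the space of linear maps $f:\mathbb{K}[C_n]\otimes A^{\otimes n}\to A$ with $\alpha(f([r];a_1,\dots,a_n))=f([r];\alpha(a_1),\dots,\alpha(a_n))$ for all $[r]\in C_n$; $C^0_{\alpha,\mathrm{Dend}}(A,A)=0$. For $f$ of arity $m$, $g$ of arity $n$, $1\le i\le m$: $$(f\bullet_i g)([r];a_1,\dots,a_{m+n-1})=f\big(R_0[r];\alpha^{n-1}a_1,\dots,\alpha^{n-1}a_{i-1},g(R_i[r];a_i,\dots,a_{i+n-1}),\alpha^{n-1}a_{i+n},\dots,\alpha^{n-1}a_{m+n-1}\big),$$ and $f\bullet g=\sum_{i=1}^m(-1)^{(i-1)(n-1)}f\bullet_i g$. Let $\pi([1];a,b)=a\prec b$, $\pi([2];a,b)=a\succ b$. The differential is $\delta_{\alpha,\mathrm{Dend}}(f)=\pi\bullet f-(-1)^{n-1}f\bullet\pi$ for $f\in C^n_{\alpha,\mathrm{Dend}}(A,A)$, and $H^n_{\alpha,\mathrm{Dend}}(A,A)$ is its cohomology. Deformations of order $n$. A deformation of $A$ of order $n$ is a pair $\prec_t=\sum_{i=0}^n\prec_it^i$, $\succ_t=\sum_{i=0}^n\succ_it^i$ with $\prec_i,\succ_i$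 bilinear maps on $A$ satisfying $\alpha(a\prec_ib)=\alpha(a)\prec_i\alpha(b)$, $\alpha(a\succ_ib)=\alpha(a)\succ_i\alpha(b)$, $\prec_0=\prec$, $\succ_0=\succ$, which satisfies the hom-dendriform identities modulo $t^{n+1}$. Writing $\pi_i\in C^2_{\alpha,\mathrm{Dend}}(A,A)$ for the element $\pi_i([1];a,b)=a\prec_ib$, $\pi_i([2];a,b)=a\succ_ib$ (so $\pi_0=\pi$), the last condition says $\sum_{i+j=k}\pi_i\bullet\pi_j=0$ for $0\le k\le n$. *)

(* Defs.v *)
From HB Require Import structures.
From mathcomp Require Import all_boot all_order all_algebra.
Set Implicit Arguments.
Unset Strict Implicit.
Unset Printing Implicit Defensive.
Import GRing.Theory.
Local Open Scope ring_scope.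

Section HomDendriform.
Variables (K : fieldType) (A : lmodType K).
Variable alpha : {linear A -> A}.

Record multiplicative_hom_dendriform
    (prec succ : {bilinear A -> A -> A}) : Prop := {
  hom_dend_prec : forall a b c,
    prec (prec a b) (alpha c) = prec (alpha a) (prec b c + succ b c);
  hom_dend_mid : forall a b c,
    prec (succ a b) (alpha c) = succ (alpha a) (prec b c);
  hom_dend_succ : forall a b c,
    succ (prec a b + succ a b) (alpha c) = succ (alpha a) (succ b c);
  hom_dend_alpha_prec : forall a b,
    alpha (prec a b) = prec (alpha a) (alpha b);
  hom_dend_alpha_succ : forall a b,
    alpha (succ a b) = succ (alpha a) (alpha b)
}.

(* K[C_n] is 'rV[K]_n, and [k] is the basis vector Cbasis n (k - 1): indices
   are counted from 0.  A linear map K[C_n] (x) A^(x)n -> A is given by the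
   multilinear map K[C_n] x A^n -> A that determines it. *)
Definition Cbasis n (k : nat) : 'rV[K]_n := \row_(j < n) (j == k :> nat)%:R.

Definition multimap n := 'rV[K]_n -> {ffun 'I_n -> A} -> A.

Definition subst_arg n (a : {ffun 'I_n -> A}) (i : 'I_n) (x : A)
  : {ffun 'I_n -> A} := [ffun j => if j == i then x else a j].

(* C^n_{alpha,Dend}(A, A); for n = 0 this is the zero space, K[C_0] being 0. *)
Record is_cochain n (f : multimap n) : Prop := {
  cochain_linear_label : forall (k : K) u v a,
    f (k *: u + v) a = k *: f u a + f v a;
  cochain_linear_arg : forall u a (i : 'I_n) (k : K) x y,
    f u (subst_arg a i (k *: x + y)) =
      k *: f u (subst_arg a i x) + f u (subst_arg a i y);
  cochain_alpha : forall (r : 'I_n) a,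
    alpha (f (Cbasis n r) a) = f (Cbasis n r) [ffun j => alpha (a j)]
}.

(* R_0(m+1; 1,..,n+1,..,1) and R_{i+1}(m+1; 1,..,n+1,..,1), with n+1 in the
   (i+1)-st place, evaluated at [r+1]. *)
Definition R0 (m n i r : nat) : 'rV[K]_m.+1 :=
  if (r < i)%N then Cbasis m.+1 r
  else if (r <= i + n)%N then Cbasis m.+1 i
  else Cbasis m.+1 (r - n).

Definition Ri (n i r : nat) : 'rV[K]_n.+1 :=
  if (i <= r <= i + n)%N then Cbasis n.+1 (r - i)
  else \sum_(k < n.+1) Cbasis n.+1 k.

(* For f of arity m+1 and g of arity n+1, the product of f and g at the
   (i+1)-st place, of arity (m+1)+(n+1)-1, extended linearly from the
   labels [r] to K[C_{m+n+1}].  All arguments of inord are at most m + n. *)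
Definition bullet_at m n (f : multimap m.+1) (g : multimap n.+1) (i : 'I_m.+1)
  : multimap (m + n).+1 := fun u a =>
  \sum_(r < (m + n).+1) u ord0 r *:
    f (R0 m n i r)
      [ffun j : 'I_m.+1 =>
         if (j < i)%N then iter n alpha (a (inord j))
         else if j == i then
           g (Ri n i r) [ffun k : 'I_n.+1 => a (inord (i + k))]
         else iter n alpha (a (inord (j + n)))].

Definition bullet m n (f : multimap m.+1) (g : multimap n.+1)
  : multimap (m + n).+1 := fun u a =>
  \sum_(i < m.+1) (-1) ^+ (i * n) *: bullet_at f g i u a.

Section Cohomology.
Variables prec succ : {bilinear A -> A -> A}.

Definition pi_cochain : multimap 2 := fun u a =>
  u ord0 ord0 *: prec (a ord0) (a ord_max)
  + u ord0 ord_max *: succ (a ord0) (a ord_max).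

(* bullet f pi_cochain has arity (n + 1).+1, which is only propositionally
   equal to n.+2, the arity of bullet pi_cochain f. *)
Definition differential n : multimap n -> multimap n.+1 :=
  match n return multimap n -> multimap n.+1 with
  | 0 => fun _ _ _ => 0
  | n'.+1 => fun f u a =>
      bullet pi_cochain f u a
      - (-1) ^+ n' *:
        (ecast k (multimap k.+1) (addn1 n') (bullet f pi_cochain)) u a
  end.

Definition cocycle n (f : multimap n) : Prop :=
  is_cochain f /\ forall u a, differential f u a = 0.

Definition coboundary n : multimap n -> Prop :=
  match n return multimap n -> Prop with
  | 0 => fun f => forall u a, f u a = 0
  | n'.+1 => fun f =>
      exists2 g : multimap n', is_cochain g & differential g =2 f
  end.

(* H^n_{alpha,Dend}(A, A) = 0 *)
Definition cohomology_vanishes n : Prop :=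
  forall f : multimap n, cocycle f -> coboundary f.

(* prec_ i and succ_ i are the coefficients of t^i; those with n < i are
   irrelevant.  The identities modulo t^(n+1) are stated as the equality of
   the coefficients of t^k for all k <= n. *)
Record deformation (n : nat)
    (prec_ succ_ : nat -> {bilinear A -> A -> A}) : Prop := {
  def_prec0 : forall a b, prec_ 0%N a b = prec a b;
  def_succ0 : forall a b, succ_ 0%N a b = succ a b;
  def_alpha_prec : forall i, (i <= n)%N -> forall a b,
    alpha (prec_ i a b) = prec_ i (alpha a) (alpha b);
  def_alpha_succ : forall i, (i <= n)%N -> forall a b,
    alpha (succ_ i a b) = succ_ i (alpha a) (alpha b);
  def_dend_prec : forall k, (k <= n)%N -> forall a b c,
    \sum_(i < k.+1) prec_ i (prec_ (k - i)%N a b) (alpha c) =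
    \sum_(i < k.+1)
      prec_ i (alpha a) (prec_ (k - i)%N b c + succ_ (k - i)%N b c);
  def_dend_mid : forall k, (k <= n)%N -> forall a b c,
    \sum_(i < k.+1) prec_ i (succ_ (k - i)%N a b) (alpha c) =
    \sum_(i < k.+1) succ_ i (alpha a) (prec_ (k - i)%N b c);
  def_dend_succ : forall k, (k <= n)%N -> forall a b c,
    \sum_(i < k.+1)
      succ_ i (prec_ (k - i)%N a b + succ_ (k - i)%N a b) (alpha c) =
    \sum_(i < k.+1) succ_ i (alpha a) (succ_ (k - i)%N b c)
}.

End Cohomology.

(* op_t + op' t^(n+1), for op_t of order n *)
Definition add_term (n : nat) (op_ : nat -> {bilinear A -> A -> A})
    (op' : {bilinear A -> A -> A}) : nat -> {bilinear A -> A -> A} :=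
  fun i => if i == n.+1 then op' else op_ i.

End HomDendriform.

(* Main.v *)
(** Writing [pi_t = sum_i pi_i t^i], the obstruction to extending a deformation
    of order [n] is the coefficient of [t^(n+1)] in [pi_t \bullet pi_t], with
    [pi_(n+1) := 0].  Each of its three components is a twisted associator
    [(x q y) p alpha z - alpha x r (y s z)] of suitable choices of operations
    among [prec], [succ] and their sum.  The obstruction is a cocycle by the
    pentagon of the five bracketings of four elements, once per label of
    [C_4]: in [pi_t \bullet (pi_t \bullet pi_t) = (pi_t \bullet pi_t) \bullet pi_t]
    all lower coefficients of [pi_t \bullet pi_t] vanish.  If it is the
    differential of [g], then [pi_(n+1) := - g] extends the deformation. *)
Require Import Defs.
From HB Require Import structures.
From mathcomp Require Import all_boot all_order all_algebra.
Import GRing.Theory.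
Local Open Scope ring_scope.

Set Implicit Arguments.
Unset Strict Implicit.
Unset Printing Implicit Defensive.

(** * Sums over triples of indices with fixed total *)

Section TriangularSums.
Variable V : zmodType.
Implicit Type G : nat -> nat -> nat -> V.

(** The index triples are those with sum [N]. The nested shape is the one that appears when an
    associator inside a further operation is unfolded. *)
Definition triangular_sum N G :=
  \sum_(i < N.+1) \sum_(j < (N - i).+1) G i j (N - i - j)%N.

Lemma triangular_sum_swap23 N G :
  triangular_sum N G = triangular_sum N (fun i j k => G i k j).
Proof.
apply: eq_bigr => i _; rewrite (reindex_inj rev_ord_inj) /=.
by apply: eq_bigr => j _; rewrite subSS subKn // -ltnS.
Qed.

(** The inner range no longer depends on [i] and the condition is symmetric in both indices, so that
    the two sums can be exchanged. *)
Lemma triangular_sumE N G : triangular_sum N G =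
  \sum_(i < N.+1) \sum_(j < N.+1 | (i + j <= N)%N) G i j (N - (i + j))%N.
Proof.
apply: eq_bigr => i _.
rewrite (big_ord_widen N.+1 (fun j => G i j (N - i - j)%N)) ?ltnS ?leq_subr //.
apply: eq_big => j; last by rewrite subnDA.
by rewrite ltnS leq_subRL // -ltnS.
Qed.

Lemma triangular_sum_swap12 N G :
  triangular_sum N G = triangular_sum N (fun i j k => G j i k).
Proof.
rewrite !triangular_sumE (exchange_big_dep predT) //=.
by apply: eq_bigr => j _; apply: eq_big => [i |i _]; rewrite (addnC i j).
Qed.

Lemma triangular_sum_rot N G :
  triangular_sum N G = triangular_sum N (fun i j k => G j k i).
Proof. by rewrite triangular_sum_swap23 triangular_sum_swap12. Qed.

Lemma triangular_sumB N G H : triangular_sum N (fun i j k => G i j k - H i j k) =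
  triangular_sum N G - triangular_sum N H.
Proof.
by rewrite -sumrB; apply: eq_bigr => i _; rewrite sumrB.
Qed.

End TriangularSums.

(** * Bilinear operations and the pentagon for twisted associators *)

Section HomDendriform.
Variables (K : fieldType) (A : lmodType K).
Variable alpha : {linear A -> A}.
Local Notation bil := {bilinear A -> A -> A}.

(** An identity that carries a bilinearity proof: the instance below is keyed on it, so any function
    with such a proof can be bundled. *)
Definition bilinear_of (f : A -> A -> A) & bilinear_for *:%R *:%R f := f.

HB.instance Definition _ f (f_bilinear : bilinear_for *:%R *:%R f) :=
  bilinear_isBilinear.Build K A A A *:%R *:%R (bilinear_of f_bilinear) f_bilinear.

Definition bundle_bilinear f (f_bilinear : bilinear_for *:%R *:%R f) : bil :=
  bilinear_of f_bilinear.

Lemma zero_bilinear : bilinear_for *:%R *:%R (fun _ _ : A => 0 : A).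
Proof. by split=> z k x y /=; rewrite scaler0 addr0. Qed.

Lemma add_bilinear (p q : bil) :
  bilinear_for *:%R *:%R (fun x y => p x y + q x y).
Proof.
split=> z k x y /=; first by rewrite !linearPl scalerDr addrACA.
by rewrite !linearPr scalerDr addrACA.
Qed.

Lemma opp_bilinear (p : bil) : bilinear_for *:%R *:%R (fun x y => - p x y).
Proof. by split=> z k x y /=; rewrite ?(linearPl, linearPr) opprD scalerN. Qed.

Definition bil0 : bil := bundle_bilinear zero_bilinear.
Definition star (p q : bil) : bil := bundle_bilinear (add_bilinear p q).
Definition opp (p : bil) : bil := bundle_bilinear (opp_bilinear p).

(* Coefficient of t^N in (x q y) p (alpha z) - (alpha x) r (y s z). *)
Definition hassoc (p q r s : nat -> bil) N x y z : A :=
  \sum_(i < N.+1) (p i (q (N - i)%N x y) (alpha z)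
                   - r i (alpha x) (s (N - i)%N y z)).

(* [T1], ..., [T5] in the proof are the five bracketings of [a b c d]; the
   term [T5 = (a b)(c d)] cancels because [alpha] is multiplicative for the
   inner operations [t1] and [t3]. *)
Lemma pentagon (r1 r2 r3 s1 s2 s3 s4 t1 t2 t3 : nat -> bil) N a b c d :
  (forall i, (i <= N)%N -> {morph alpha : x y / t1 i x y}) ->
  (forall i, (i <= N)%N -> {morph alpha : x y / t3 i x y}) ->
  \sum_(i < N.+1) (r3 i (hassoc s2 t1 s1 t2 (N - i) a b c) (alpha (alpha d))
     + r1 i (alpha (alpha a)) (hassoc s4 t2 s3 t3 (N - i) b c d)) =
  \sum_(i < N.+1)
    (hassoc r3 s2 r2 t3 (N - i) (t1 i a b) (alpha c) (alpha d)
     - hassoc r3 s1 r1 s4 (N - i) (alpha a) (t2 i b c) (alpha d)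
     + hassoc r2 t1 r1 s3 (N - i) (alpha a) (alpha b) (t3 i c d)).
Proof.
move=> alpha_t1 alpha_t3.
rewrite !big_split sumrN /=.
pose T1 i j k := r3 i (s2 j (t1 k a b) (alpha c)) (alpha (alpha d)).
pose T2 i j k := r3 i (s1 j (alpha a) (t2 k b c)) (alpha (alpha d)).
pose T3 i j k := r1 i (alpha (alpha a)) (s4 j (t2 k b c) (alpha d)).
pose T4 i j k := r1 i (alpha (alpha a)) (s3 j (alpha b) (t3 k c d)).
pose T5 i j k := r2 i (t1 k (alpha a) (alpha b)) (t3 j (alpha c) (alpha d)).
have -> : \sum_(i < N.+1) r3 i (hassoc s2 t1 s1 t2 (N - i) a b c)
    (alpha (alpha d)) = triangular_sum N T1 - triangular_sum N T2.
  rewrite -triangular_sumB; apply: eq_bigr => i _.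
  by rewrite linear_sumlz; apply: eq_bigr => j _; rewrite linearBl.
have -> : \sum_(i < N.+1) r1 i (alpha (alpha a))
    (hassoc s4 t2 s3 t3 (N - i) b c d) = triangular_sum N T3 - triangular_sum N T4.
  rewrite -triangular_sumB; apply: eq_bigr => i _.
  by rewrite linear_sumr; apply: eq_bigr => j _; rewrite linearBr.
have -> : \sum_(i < N.+1) hassoc r3 s2 r2 t3 (N - i) (t1 i a b) (alpha c)
    (alpha d) = triangular_sum N T1 - triangular_sum N T5.
  (* Here the outer summation index belongs to the inner operation [t1], while in [T1] and [T5] it
     belongs to the outermost one; rotating the indices aligns the two. *)
  rewrite (triangular_sum_rot _ T1) (triangular_sum_rot _ T5) -triangular_sumB.
  apply: eq_bigr => i _; apply: eq_bigr => j _.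
  by rewrite alpha_t1 // -ltnS.
have -> : \sum_(i < N.+1) hassoc r3 s1 r1 s4 (N - i) (alpha a) (t2 i b c)
    (alpha d) = triangular_sum N T2 - triangular_sum N T3.
  by rewrite (triangular_sum_rot _ T2) (triangular_sum_rot _ T3) -triangular_sumB.
have -> : \sum_(i < N.+1) hassoc r2 t1 r1 s3 (N - i) (alpha a) (alpha b)
    (t3 i c d) = triangular_sum N T5 - triangular_sum N T4.
  rewrite (triangular_sum_swap23 _ T5) (triangular_sum_rot _ T4).
  rewrite (triangular_sum_rot _ (fun i j k => T5 i k j)) -triangular_sumB.
  apply: eq_bigr => i _; apply: eq_bigr => j _.
  by rewrite alpha_t3 // -ltnS.
move: (triangular_sum N T1) (triangular_sum N T5) => X1 X5.
rewrite opprB !addrA; congr (_ - _).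
by rewrite !(addrAC _ (- X5)) addrK addrAC.
Qed.

(** The three dendriform identities add up to hom-associativity of the total operation; this is the
    same computation for their defects. *)
Lemma hassoc_star (p q : nat -> bil) N x y z :
  let s i := star (p i) (q i) in
  hassoc s s s s N x y z =
  hassoc p p p s N x y z + hassoc p q q p N x y z + hassoc q s q q N x y z.
Proof.
rewrite /hassoc -!big_split; apply: eq_bigr => i _ /=.
rewrite /bilinear_of !linearDl !linearDr.
have addr3B (a b c d e f : A) :
    a + b + c - (d + e + f) = a - d + (b - e) + (c - f).
  by rewrite !opprD addrACA (addrACA a).
by rewrite (addrA (p i (alpha x) _ + _)) addr3B.
Qed.

(** In [pentagon] the summand of index [i] contains associators of degree [N - i], so vanishing
    below [N] leaves only [i = 0]. *)
Lemma pentagon_obstruction (r1 r2 r3 s1 s2 s3 s4 t1 t2 t3 : nat -> bil) N a b c d :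
  (forall i, (i <= N)%N -> {morph alpha : x y / t1 i x y}) ->
  (forall i, (i <= N)%N -> {morph alpha : x y / t3 i x y}) ->
  (forall k, (k < N)%N -> forall x y z, hassoc s2 t1 s1 t2 k x y z = 0) ->
  (forall k, (k < N)%N -> forall x y z, hassoc s4 t2 s3 t3 k x y z = 0) ->
  (forall k, (k < N)%N -> forall x y z, hassoc r3 s2 r2 t3 k x y z = 0) ->
  (forall k, (k < N)%N -> forall x y z, hassoc r3 s1 r1 s4 k x y z = 0) ->
  (forall k, (k < N)%N -> forall x y z, hassoc r2 t1 r1 s3 k x y z = 0) ->
  r3 0%N (hassoc s2 t1 s1 t2 N a b c) (alpha (alpha d))
  + r1 0%N (alpha (alpha a)) (hassoc s4 t2 s3 t3 N b c d) =
  hassoc r3 s2 r2 t3 N (t1 0%N a b) (alpha c) (alpha d)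
  - hassoc r3 s1 r1 s4 N (alpha a) (t2 0%N b c) (alpha d)
  + hassoc r2 t1 r1 s3 N (alpha a) (alpha b) (t3 0%N c d).
Proof.
move=> alpha_t1 alpha_t3 H1 H2 H3 H4 H5.
have := @pentagon r1 r2 r3 s1 s2 s3 s4 t1 t2 t3 N a b c d alpha_t1 alpha_t3.
have lt_sub (i : 'I_N) : (N - lift ord0 i < N)%N.
  by rewrite lift0 ltn_subrL /=; apply: leq_ltn_trans (ltn_ord i).
rewrite !big_ord_recl /= subn0 !big1 ?addr0 // => i _.
  by rewrite H3 ?H4 ?H5 ?lt_sub // subr0 addr0.
by rewrite H1 ?H2 ?lt_sub // linear0l linear0r addr0.
Qed.

(** * Cochains of arity two to four and their products, label by label *)

Definition binary_cochain (p q : A -> A -> A) : multimap A 2 := fun u a =>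
  u ord0 ord0 *: p (a ord0) (a ord_max) + u ord0 ord_max *: q (a ord0) (a ord_max).

Definition ternary_cochain (p q r : A -> A -> A -> A) : multimap A 3 := fun u a =>
  let op f := f (a (inord 0)) (a (inord 1)) (a (inord 2)) in
  u ord0 (inord 0) *: op p + (u ord0 (inord 1) *: op q + u ord0 (inord 2) *: op r).

Lemma R0E m n i r (j : 'I_m.+1) : R0 K m n i r ord0 j =
  (j == (if r < i then r else if r <= i + n then i else r - n) :> nat)%N%:R.
Proof. by rewrite /R0; do 2?case: ifP => _; rewrite mxE. Qed.

Lemma RiE n i r (j : 'I_n.+1) : Ri K n i r ord0 j =
  (if (i <= r <= i + n)%N then (j == r - i :> nat)%N else true)%:R.
Proof.
rewrite /Ri; case: ifP => _; first by rewrite mxE.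
rewrite summxE (bigD1 j) //= mxE eqxx big1 ?addr0 // => k kj.
by rewrite mxE eq_sym val_eqE (negPf kj).
Qed.

Lemma addrACA4 (a b c d a' b' c' d' : A) :
  a + (b + (c + d)) + (a' + (b' + (c' + d'))) =
  a + a' + (b + b' + (c + c' + (d + d'))).
Proof. by rewrite addrACA (addrACA b) (addrACA c). Qed.

Lemma addrBACA4 (a b c d a' b' c' d' a'' b'' c'' d'' : A) :
  a + (b + (c + d)) + (- (a' + (b' + (c' + d'))) + (a'' + (b'' + (c'' + d'')))) =
  a - a' + a'' + (b - b' + b'' + (c - c' + c'' + (d - d' + d''))).
Proof. by rewrite addrA !opprD (addrACA4 a) addrACA4. Qed.

Lemma ord0_inord n : ord0 = inord 0 :> 'I_n.+1.
Proof. by apply: val_inj; rewrite /= inordK. Qed.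

Lemma lift0_ord0 n : lift ord0 ord0 = inord 1 :> 'I_n.+2.
Proof. by apply: val_inj; rewrite /= inordK. Qed.

Lemma lift0_inord n k : (k <= n)%N -> lift ord0 (inord k) = inord k.+1 :> 'I_n.+2.
Proof. by move=> le_kn; apply: val_inj; rewrite /= !inordK. Qed.

(** [R0] selects the outer operation and [Ri] the inner one; a label outside the inner block gives
    the sum of both inner operations. The second insertion has sign -1. *)
Lemma bullet_binary_binary p q p' q' u (a : {ffun 'I_3 -> A}) :
  bullet alpha (binary_cochain p q) (binary_cochain p' q') u a =
  ternary_cochain
    (fun x y z => p (p' x y) (alpha z) - p (alpha x) (p' y z + q' y z))
    (fun x y z => p (q' x y) (alpha z) - q (alpha x) (p' y z))
    (fun x y z => q (p' x y + q' x y) (alpha z) - q (alpha x) (q' y z)) u a.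
Proof.
rewrite /bullet /bullet_at /binary_cochain /ternary_cochain /=.
rewrite !big_ord_recl !big_ord0 /= !R0E !RiE !ffunE /=.
rewrite !(expr0, expr1, scale1r, scale0r, addr0, add0r, scaleN1r) /=.
rewrite !lift0_ord0 !lift0_inord // (ord0_inord 2) /addn /bump /=.
rewrite opprD addrACA !scalerBr; congr (_ + _).
by rewrite opprD addrACA.
Qed.

(** The arguments are already fixed, so the components are elements of [A] and two such values can
    be compared label by label. *)
Definition quaternary_cochain (p q r s : A) : 'rV[K]_4 -> A := fun u =>
  u ord0 (inord 0) *: p + (u ord0 (inord 1) *: q
  + (u ord0 (inord 2) *: r + u ord0 (inord 3) *: s)).

(** The components have the shape of the left-hand side of [pentagon_obstruction]: the inner arity 3
    makes both signs + and applies [alpha] twice to the outside argument. *)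
Lemma bullet_binary_ternary p q p1 p2 p3 u (a : {ffun 'I_4 -> A}) :
  let x := a (inord 0) in let y := a (inord 1) in
  let z := a (inord 2) in let t := a (inord 3) in
  let p4 x y z := p1 x y z + (p2 x y z + p3 x y z) in
  bullet alpha (binary_cochain p q) (ternary_cochain p1 p2 p3) u a =
  quaternary_cochain
    (p (p1 x y z) (alpha (alpha t)) + p (alpha (alpha x)) (p4 y z t))
    (p (p2 x y z) (alpha (alpha t)) + q (alpha (alpha x)) (p1 y z t))
    (p (p3 x y z) (alpha (alpha t)) + q (alpha (alpha x)) (p2 y z t))
    (q (p4 x y z) (alpha (alpha t)) + q (alpha (alpha x)) (p3 y z t)) u.
Proof.
move=> /=.
rewrite /bullet /bullet_at /binary_cochain /ternary_cochain /=.
rewrite !big_ord_recl !big_ord0 /= !R0E !RiE !ffunE /=.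
rewrite !inordK //.
rewrite !(expr0, expr1, scale1r, scale0r, addr0, add0r, scaleN1r) /=.
rewrite !lift0_ord0 !lift0_inord // (ord0_inord 3) /addn /bump /=.
rewrite (_ : (-1) ^+ _ = 1 :> K); last exact: etrans (sqrrN 1) (expr1n _ 2).
rewrite scale1r /quaternary_cochain !scalerDr.
exact: addrACA4.
Qed.

(** The components have the shape of the right-hand side of [pentagon_obstruction]: the inner arity
    2 gives the signs +, -, + and a single [alpha] on each outside argument. *)
Lemma bullet_ternary_binary p1 p2 p3 p q u (a : {ffun 'I_4 -> A}) :
  let x := a (inord 0) in let y := a (inord 1) in
  let z := a (inord 2) in let t := a (inord 3) in
  let s x y := p x y + q x y in
  bullet alpha (ternary_cochain p1 p2 p3) (binary_cochain p q) u a =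
  quaternary_cochain
    (p1 (p x y) (alpha z) (alpha t) - p1 (alpha x) (s y z) (alpha t)
     + p1 (alpha x) (alpha y) (s z t))
    (p1 (q x y) (alpha z) (alpha t) - p2 (alpha x) (p y z) (alpha t)
     + p2 (alpha x) (alpha y) (s z t))
    (p2 (s x y) (alpha z) (alpha t) - p2 (alpha x) (q y z) (alpha t)
     + p3 (alpha x) (alpha y) (p z t))
    (p3 (s x y) (alpha z) (alpha t) - p3 (alpha x) (s y z) (alpha t)
     + p3 (alpha x) (alpha y) (q z t)) u.
Proof.
move=> /=.
rewrite /bullet /bullet_at /binary_cochain /ternary_cochain /=.
rewrite !big_ord_recl !big_ord0 /= !R0E !RiE !ffunE /=.
rewrite -!val_eqE /= !inordK //=.
rewrite !(expr0, expr1, scale1r, scale0r, addr0, add0r, scaleN1r) /=.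
rewrite !lift0_ord0 !lift0_inord // (ord0_inord 3) /addn /bump /=.
rewrite (_ : (-1) ^+ _ = 1 :> K); last exact: etrans (sqrrN 1) (expr1n _ 2).
rewrite scale1r /quaternary_cochain !scalerDr !scalerN.
by rewrite addrBACA4.
Qed.

Lemma eq_bullet m n (f f' : multimap A m.+1) (g g' : multimap A n.+1) :
  f =2 f' -> g =2 g' -> bullet alpha f g =2 bullet alpha f' g'.
Proof.
move=> eq_f eq_g u a; apply: eq_bigr => i _; congr (_ *: _).
apply: eq_bigr => r _; congr (_ *: _); rewrite eq_f; congr (f' _ _).
by apply/ffunP => j; rewrite !ffunE eq_g.
Qed.

Lemma differential_ternary (prec succ : bil) (f : multimap A 3) u a :
  differential alpha prec succ f u a =
  bullet alpha (binary_cochain prec succ) f u a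
  - bullet alpha f (binary_cochain prec succ) u a.
Proof.
(* Both sides of [addn1 2] compute to 3, and equality proofs in [nat] are unique, so the cast
   disappears. *)
rewrite /differential (eq_irrelevance (addn1 2) erefl) /=.
by rewrite (_ : (-1) ^+ 2 = 1 :> K) ?scale1r // sqrrN expr1n.
Qed.

Lemma differential_binary (prec succ : bil) (f : multimap A 2) u a :
  differential alpha prec succ f u a =
  bullet alpha (binary_cochain prec succ) f u a
  + bullet alpha f (binary_cochain prec succ) u a.
Proof.
rewrite /differential (eq_irrelevance (addn1 1) erefl) /=.
by rewrite expr1 scaleN1r opprK.
Qed.

(** * 2-cochains as pairs of multiplicative bilinear operations *)

Lemma cochain_labelZ n (f : multimap A n) k u a :
  is_cochain alpha f -> f (k *: u) a = k *: f u a.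
Proof.
case=> f_linear _ _.
(* Writing [k] as [(k - 1) + 1] brings the label into the form [k' *: u + u] of the linearity axiom,
   without first computing [f] at 0. *)
rewrite -[k in LHS](subrK 1) scalerDl scale1r f_linear.
by rewrite -[X in _ + X]scale1r -scalerDl subrK.
Qed.

Definition ffun2 (x y : A) : {ffun 'I_2 -> A} :=
  [ffun i => if i == ord0 then x else y].

Lemma ffun2_ext (a b : {ffun 'I_2 -> A}) :
  a ord0 = b ord0 -> a ord_max = b ord_max -> a = b.
Proof.
move=> ab0 ab1; apply/ffunP => i; have [->//|ne_i0] := eqVneq i ord0.
suff -> : i = ord_max by [].
by apply: val_inj; case: i ne_i0 => [[|[|]]].
Qed.

(** The two operations are the values of [g] at the two basis labels; linearity in the label
    recovers [g] from them. *)
Lemma binary_cochainP (g : multimap A 2) : is_cochain alpha g ->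
  exists p q : bil, [/\ g =2 binary_cochain p q,
    {morph alpha : x y / p x y} & {morph alpha : x y / q x y}].
Proof.
move=> g_cochain; have [g_label g_arg g_alpha] := g_cochain.
have bilin k : bilinear_for *:%R *:%R (fun x y => g (Cbasis K 2 k) (ffun2 x y)).
  split=> z c x y /=.
    (* The filler 0 is overwritten by [subst_arg]; only the form required by linearity in an
       argument matters. *)
    have E w : ffun2 w z = subst_arg (ffun2 0 z) ord0 w.
      by apply: ffun2_ext; rewrite !ffunE.
    by rewrite (E (_ + _)) (E x) (E y) g_arg.
  have E w : ffun2 z w = subst_arg (ffun2 z 0) ord_max w.
    by apply: ffun2_ext; rewrite !ffunE.
  by rewrite (E (_ + _)) (E x) (E y) g_arg.
have alphaE (r : 'I_2) : {morph alpha : x y / g (Cbasis K 2 r) (ffun2 x y)}.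
  by move=> x y; rewrite g_alpha; congr (g _ _); apply: ffun2_ext; rewrite !ffunE.
exists (bundle_bilinear (bilin 0%N)), (bundle_bilinear (bilin 1%N)); split.
- move=> u a; rewrite /binary_cochain /= /bilinear_of.
  have <- : a = ffun2 (a ord0) (a ord_max) by apply: ffun2_ext; rewrite !ffunE.
  (* Linearity, read backwards, collects both terms into [g] at the expansion of [u] in the
     basis. *)
  rewrite -(cochain_labelZ (u _ ord_max)) // -g_label; congr (g _ _).
  apply/rowP => j; rewrite !mxE.
  by case: j => [[|[|//]] ltj] /=; rewrite ?mulr0 ?mulr1 ?addr0 ?add0r;
    congr (u _ _); apply: val_inj.
- exact: (alphaE ord0).
- exact: (alphaE ord_max).
Qed.

(** * The obstruction is a 3-cocycle *)

Record trilinear_equivariant (f : A -> A -> A -> A) : Prop := {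
  trilinear1 : forall k x x' y z, f (k *: x + x') y z = k *: f x y z + f x' y z;
  trilinear2 : forall k x y y' z, f x (k *: y + y') z = k *: f x y z + f x y' z;
  trilinear3 : forall k x y z z', f x y (k *: z + z') = k *: f x y z + f x y z';
  trilinear_alpha : forall x y z, alpha (f x y z) = f (alpha x) (alpha y) (alpha z)
}.

Lemma ternary_cochain_is_cochain p q r :
  trilinear_equivariant p -> trilinear_equivariant q ->
  trilinear_equivariant r -> is_cochain alpha (ternary_cochain p q r).
Proof.
move=> [p1 p2 p3 pa] [q1 q2 q3 qa] [r1 r2 r3 ra].
have combine (k c0 c1 c2 : K) (x0 x1 x2 y0 y1 y2 : A) :
    c0 *: (k *: x0 + y0) + (c1 *: (k *: x1 + y1) + c2 *: (k *: x2 + y2)) =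
    k *: (c0 *: x0 + (c1 *: x1 + c2 *: x2)) + (c0 *: y0 + (c1 *: y1 + c2 *: y2)).
  rewrite !scalerDr !scalerA !(mulrC k) [RHS]addrACA; congr (_ + _).
  by rewrite [RHS]addrACA.
split=> [k u v a|u a i k x y|i a]; rewrite /ternary_cochain.
- rewrite !mxE !scalerDl -!scalerA !scalerDr [RHS]addrACA; congr (_ + _).
  by rewrite [RHS]addrACA.
- case: i => [[|[|[|//]]] lti]; rewrite !ffunE -!val_eqE /= !inordK //=.
  + by rewrite p1 q1 r1 combine.
  + by rewrite p2 q2 r2 combine.
  + by rewrite p3 q3 r3 combine.
- by rewrite !linearD !linearZ /= pa qa ra !ffunE.
Qed.

Lemma hassoc_trilinear_equivariant (p q r s : nat -> bil) N :
  (forall i, (i <= N)%N -> {morph alpha : x y / p i x y}) ->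
  (forall i, (i <= N)%N -> {morph alpha : x y / q i x y}) ->
  (forall i, (i <= N)%N -> {morph alpha : x y / r i x y}) ->
  (forall i, (i <= N)%N -> {morph alpha : x y / s i x y}) ->
  trilinear_equivariant (hassoc p q r s N).
Proof.
move=> pa qa ra sa; split=> [k x x' y z|k x y y' z|k x y z z'|x y z].
- rewrite /hassoc scaler_sumr -big_split; apply: eq_bigr => i _ /=.
  by rewrite linearP !linearPl scalerBr opprD addrACA.
- rewrite /hassoc scaler_sumr -big_split; apply: eq_bigr => i _ /=.
  by rewrite !(linearPl, linearPr) scalerBr opprD addrACA.
- rewrite /hassoc scaler_sumr -big_split; apply: eq_bigr => i _ /=.
  by rewrite linearP !linearPr scalerBr opprD addrACA.
rewrite /hassoc linear_sum; apply: eq_bigr => i _.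
have le_iN : (i <= N)%N by rewrite -ltnS.
by rewrite linearB /= pa // qa ?leq_subr // ra // sa ?leq_subr.
Qed.

Lemma star_alpha (p q : bil) :
  {morph alpha : x y / p x y} -> {morph alpha : x y / q x y} ->
  {morph alpha : x y / star p q x y}.
Proof. by move=> pa qa x y; rewrite /= /bilinear_of linearD pa qa. Qed.

Lemma obstruction_cocycle (prec succ : bil) (p q : nat -> bil) N :
  let s i := star (p i) (q i) in
  p 0%N =2 prec -> q 0%N =2 succ ->
  (forall i, (i <= N)%N -> {morph alpha : x y / p i x y}) ->
  (forall i, (i <= N)%N -> {morph alpha : x y / q i x y}) ->
  (forall k, (k < N)%N -> forall x y z, hassoc p p p s k x y z = 0) ->
  (forall k, (k < N)%N -> forall x y z, hassoc p q q p k x y z = 0) ->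
  (forall k, (k < N)%N -> forall x y z, hassoc q s q q k x y z = 0) ->
  cocycle alpha prec succ
    (ternary_cochain (hassoc p p p s N) (hassoc p q q p N) (hassoc q s q q N)).
Proof.
move=> s p0 q0 pa qa H1 H2 H3.
have sa i : (i <= N)%N -> {morph alpha : x y / s i x y}.
  by move=> le_iN; apply: star_alpha; [apply: pa | apply: qa].
(* The associator of the total operation enters the first and last labels, where [Ri] sums over all
   three labels. *)
have H4 k : (k < N)%N -> forall x y z, hassoc s s s s k x y z = 0.
  by move=> lt_kN x y z; rewrite hassoc_star H1 ?H2 ?H3 ?addr0.
have sE x y : prec x y + succ x y = s 0%N x y by rewrite /= /bilinear_of p0 q0.
split; first by apply: ternary_cochain_is_cochain;
  apply: hassoc_trilinear_equivariant.
move=> u a; rewrite differential_ternary bullet_binary_ternary.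
rewrite bullet_ternary_binary /= !addrA -!hassoc_star -/s !sE -!p0 -!q0.
apply/eqP; rewrite subr_eq0; apply/eqP; congr quaternary_cochain.
(* One pentagon per label of C_4; unification reads off its ten operations. *)
- exact: pentagon_obstruction.
- exact: pentagon_obstruction.
- exact: pentagon_obstruction.
- exact: pentagon_obstruction.
Qed.

(** * Deformation equations as vanishing associators, and the effect of a new coefficient *)

Lemma hassoc_eq_dendriform (p q r s : nat -> bil) N x y z :
  hassoc p q r s N x y z = 0 <->
  \sum_(i < N.+1) p i (q (N - i)%N x y) (alpha z) =
  \sum_(i < N.+1) r i (alpha x) (s (N - i)%N y z).
Proof.
by rewrite /hassoc sumrB; split=> [/eqP|->]; rewrite ?subrr // subr_eq0 => /eqP.
Qed.

Lemma eq_hassoc (p q r s p' q' r' s' : nat -> bil) N x y z :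
  (forall i, (i <= N)%N -> [/\ p i =2 p' i, q i =2 q' i, r i =2 r' i & s i =2 s' i]) ->
  hassoc p q r s N x y z = hassoc p' q' r' s' N x y z.
Proof.
move=> E; apply: eq_bigr => i _.
have [//|Ep _ Er _] := E i; first by rewrite -ltnS.
have [|_ Eq _ Es] := E (N - i)%N; first exact: leq_subr.
by rewrite Ep Er Eq Es.
Qed.

(** The two indices in a summand add up to [n.+1], so the new coefficient occurs only at the two
    ends, paired with degree 0. These end terms are the components of [bullet] of degree 0 with the
    new coefficient, in both orders; the rest is the obstruction. *)
Lemma hassoc_top (p q r s p' q' r' s' : nat -> bil) n x y z :
  (forall i, (i <= n)%N -> [/\ p i =2 p' i, q i =2 q' i, r i =2 r' i & s i =2 s' i]) ->
  [/\ p n.+1 =2 bil0, q n.+1 =2 bil0, r n.+1 =2 bil0 & s n.+1 =2 bil0] ->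
  hassoc p' q' r' s' n.+1 x y z =
  p' 0%N (q' n.+1 x y) (alpha z) - r' 0%N (alpha x) (s' n.+1 y z)
  + (p' n.+1 (q' 0%N x y) (alpha z) - r' n.+1 (alpha x) (s' 0%N y z))
  + hassoc p q r s n.+1 x y z.
Proof.
move=> E [p0 q0 r0 s0].
rewrite /hassoc !(big_ord_recr n.+1) /= subnn p0 r0 subrr addr0.
rewrite !(big_ord_recl n) /= subn0 q0 s0 /= /bilinear_of linear0l linear0r subrr.
rewrite add0r addrAC; congr (_ + _); apply: eq_bigr => i _.
have [|Ep _ Er _] := E (bump 0 i); first exact: ltn_ord.
have [|_ Eq _ Es] := E (n.+1 - bump 0 i)%N; first by rewrite subSS leq_subr.
by rewrite Ep Er Eq Es.
Qed.

Definition ffun3 (x y z : A) : {ffun 'I_3 -> A} :=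
  [ffun i : 'I_3 => [:: x; y; z]`_i].

Lemma ternary_cochain_basis p q r x y z :
  (ternary_cochain p q r (Cbasis K 3 0) (ffun3 x y z) = p x y z) *
  (ternary_cochain p q r (Cbasis K 3 1) (ffun3 x y z) = q x y z) *
  (ternary_cochain p q r (Cbasis K 3 2) (ffun3 x y z) = r x y z).
Proof.
by rewrite /ternary_cochain !ffunE !mxE !inordK //= !scale1r !scale0r !addr0 !add0r.
Qed.

Lemma add_term_le n (p : nat -> bil) p' i : (i <= n)%N -> add_term n p p' i = p i.
Proof. by rewrite /add_term; case: eqP => // ->; rewrite ltnn. Qed.

Lemma add_term_top n (p : nat -> bil) p' : add_term n p p' n.+1 = p'.
Proof. by rewrite /add_term eqxx. Qed.

Lemma add_term_alpha n (p : nat -> bil) (p' : bil) :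
  (forall i, (i <= n)%N -> {morph alpha : x y / p i x y}) ->
  {morph alpha : x y / p' x y} ->
  forall i, (i <= n.+1)%N -> {morph alpha : x y / add_term n p p' i x y}.
Proof.
move=> pa p'a i; rewrite leq_eqVlt => /predU1P[->|le_in].
  by rewrite add_term_top.
by rewrite add_term_le //; apply: pa.
Qed.

(** Degrees up to [n] do not see the added term, whatever it is; this serves both the extension by
    zero and the final one. *)
Lemma deformation_hassoc (prec succ : bil) n (prec_ succ_ : nat -> bil)
    (prec' succ' : bil) k x y z :
  deformation alpha prec succ n prec_ succ_ -> (k <= n)%N ->
  let p := add_term n prec_ prec' in let q := add_term n succ_ succ' in
  let s i := star (p i) (q i) in
  [/\ hassoc p p p s k x y z = 0, hassoc p q q p k x y z = 0
    & hassoc q s q q k x y z = 0].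
Proof.
move=> [_ _ _ _ H1 H2 H3] le_kn p q s; pose s_ i := star (prec_ i) (succ_ i).
have E i : (i <= k)%N -> [/\ p i = prec_ i, q i = succ_ i & s i = s_ i].
  by move=> le_ik; rewrite /s /p /q !add_term_le // (leq_trans le_ik).
split.
- rewrite (@eq_hassoc _ _ _ _ prec_ prec_ prec_ s_).
    exact/hassoc_eq_dendriform/H1.
  by move=> i /E[-> _ ->].
- rewrite (@eq_hassoc _ _ _ _ prec_ succ_ succ_ prec_).
    exact/hassoc_eq_dendriform/H2.
  by move=> i /E[-> -> _].
- rewrite (@eq_hassoc _ _ _ _ succ_ s_ succ_ succ_).
    exact/hassoc_eq_dendriform/H3.
  by move=> i /E[_ -> ->].
Qed.

End HomDendriform.

(** * Extending a deformation by a primitive of its obstruction *)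

Theorem theorem4p9 (K : fieldType) (charK : [pchar K] =i pred0)
    (A : lmodType K) (alpha : {linear A -> A})
    (prec succ : {bilinear A -> A -> A})
    (HA : multiplicative_hom_dendriform alpha prec succ)
    (H3 : cohomology_vanishes alpha prec succ 3)
    (n : nat) (prec_ succ_ : nat -> {bilinear A -> A -> A})
    (Hdef : deformation alpha prec succ n prec_ succ_) :
  exists prec' succ' : {bilinear A -> A -> A},
    deformation alpha prec succ n.+1
      (add_term n prec_ prec') (add_term n succ_ succ').
Proof.
have [p0 q0 pa qa _ _ _] := Hdef.
(* The coefficients beyond [n] are arbitrary, so the one of index [n.+1] is reset to zero before the
   obstruction is formed. *)
pose P := add_term n prec_ (bil0 A); pose Q := add_term n succ_ (bil0 A).
pose s i := star (P i) (Q i).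
have zero_alpha : {morph alpha : x y / bil0 A x y}.
  by move=> x y; rewrite /= /bilinear_of linear0.
have h_cocycle : cocycle alpha prec succ (ternary_cochain
    (hassoc alpha P P P s n.+1) (hassoc alpha P Q Q P n.+1)
    (hassoc alpha Q s Q Q n.+1)).
  apply: obstruction_cocycle.
  - by move=> x y; rewrite /P add_term_le.
  - by move=> x y; rewrite /Q add_term_le.
  - exact: add_term_alpha.
  - exact: add_term_alpha.
  - by move=> k lt_kn x y z;
      have [] := deformation_hassoc (bil0 A) (bil0 A) x y z Hdef lt_kn.
  - by move=> k lt_kn x y z;
      have [] := deformation_hassoc (bil0 A) (bil0 A) x y z Hdef lt_kn.
  - by move=> k lt_kn x y z;
      have [] := deformation_hassoc (bil0 A) (bil0 A) x y z Hdef lt_kn.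
have [g g_cochain dg] := H3 _ h_cocycle.
have [p [q [gE p_alpha q_alpha]]] := binary_cochainP g_cochain.
have dgE u a : differential alpha prec succ g u a =
    bullet alpha (binary_cochain prec succ) (binary_cochain p q) u a
    + bullet alpha (binary_cochain p q) (binary_cochain prec succ) u a.
  by rewrite differential_binary; congr (_ + _); apply: eq_bullet.
pose p' := opp p; pose q' := opp q.
have vanish_top x y z :
    let P' := add_term n prec_ p' in let Q' := add_term n succ_ q' in
    let t i := star (P' i) (Q' i) in
    [/\ hassoc alpha P' P' P' t n.+1 x y z = 0,
        hassoc alpha P' Q' Q' P' n.+1 x y z = 0
      & hassoc alpha Q' t Q' Q' n.+1 x y z = 0].
  move=> P' Q' t.
  have E i : (i <= n)%N -> [/\ P i = P' i, Q i = Q' i & s i = t i].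
    by move=> le_in; rewrite /s /t /P /Q /P' /Q' !add_term_le.
  have Ptop : P n.+1 =2 bil0 A by move=> v w; rewrite /P add_term_top.
  have Qtop : Q n.+1 =2 bil0 A by move=> v w; rewrite /Q add_term_top.
  have stop : s n.+1 =2 bil0 A.
    by move=> v w; rewrite /s /= /bilinear_of Ptop Qtop addr0.
  have P'top : P' n.+1 = p' by exact: add_term_top.
  have Q'top : Q' n.+1 = q' by exact: add_term_top.
  have P'0 v w : P' 0%N v w = prec v w by rewrite /P' add_term_le // p0.
  have Q'0 v w : Q' 0%N v w = succ v w by rewrite /Q' add_term_le // q0.
  (* At the three basis labels, the equation between the differential of [g] and the obstruction
     splits into its components [b1], [b2], [b3]. *)
  have coef k := etrans (esym (dgE (Cbasis K 3 k) (ffun3 x y z))) (dg _ _).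
  have := (coef 0%N, coef 1%N, coef 2%N).
  rewrite !bullet_binary_binary !ternary_cochain_basis => -[[b1 b2] b3].
  have tE i v w : t i v w = P' i v w + Q' i v w by [].
  split.
  - rewrite (@hassoc_top _ _ alpha P P P s); [|by move=> i /E[-> _ ->]|by split].
    (* [b1] turns the obstruction into a component of the differential of [g], which the end terms
       in [- p] and [- q] cancel. *)
    rewrite !tE P'top Q'top !P'0 !Q'0 -b1 /= /bilinear_of -!opprD.
    by rewrite !linearNl !linearNr -!opprD addNr.
  - rewrite (@hassoc_top _ _ alpha P Q Q P); [|by move=> i /E[-> -> _]|by split].
    rewrite P'top Q'top !P'0 !Q'0 -b2 /= /bilinear_of.
    by rewrite !linearNl !linearNr -!opprD addNr.
  - rewrite (@hassoc_top _ _ alpha Q s Q Q); [|by move=> i /E[_ -> ->]|by split].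
    rewrite !tE P'top Q'top !P'0 !Q'0 -b3 /= /bilinear_of -!opprD.
    by rewrite !linearNl !linearNr -!opprD addNr.
exists p', q'; split.
- by move=> a b; rewrite add_term_le.
- by move=> a b; rewrite add_term_le.
- by apply: add_term_alpha => // x y; rewrite /= /bilinear_of linearN p_alpha.
- by apply: add_term_alpha => // x y; rewrite /= /bilinear_of linearN q_alpha.
(* The sum of the two operations is written out in the goal; the pattern [star _ _] lets unification
   recognise it as one bilinear map. *)
- move=> k le_kn x y z; apply/(@hassoc_eq_dendriform _ _ _ _ _ _ (fun i => star _ _)).
  move: le_kn; rewrite leq_eqVlt => /predU1P[->|lt_kn].
    by have [] := vanish_top x y z.
  by have [] := deformation_hassoc p' q' x y z Hdef lt_kn.
- move=> k le_kn x y z; apply/hassoc_eq_dendriform.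
  move: le_kn; rewrite leq_eqVlt => /predU1P[->|lt_kn].
    by have [] := vanish_top x y z.
  by have [] := deformation_hassoc p' q' x y z Hdef lt_kn.
- move=> k le_kn x y z; apply/(@hassoc_eq_dendriform _ _ _ _ (fun i => star _ _)).
  move: le_kn; rewrite leq_eqVlt => /predU1P[->|lt_kn].
    by have [] := vanish_top x y z.
  by have [] := deformation_hassoc p' q' x y z Hdef lt_kn.
Qed.
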